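(* Let $D$ be an infinite division ring, $I$ a set, and $\mathcal{F}$ a filter on $I$ which is not the intersection of finitely many $\mathrm{card}(D)^+$-complete ultrafilters. Then $$\dim_D\,(D^I/\mathcal{F})\ =\ \mathrm{card}(D^I/\mathcal{F}),$$ where $\dim_D$ can be taken to mean the dimension either as a right or as a left $D$-vector space.
   Context: A filter on $I$ is a set of subsets of $I$ containing $I$, closed under passing to larger subsets of $I$, and closed under pairwise intersections; it may be improper (equal to the set of all subsets of $I$). An ultrafilter is a maximal proper filter. A filter is $\kappa$-complete ($\kappa$ an infinite cardinal) if it is closed under intersections of families of $<\kappa$ members. Convention: the intersection of the empty family of ultrafilters is the improper filter, and ''finitely many'' allows zero. $\mathrm{card}(D)^+$ is the successor cardinal of $\mathrm{card}(D)$. $D^I/\mathcal{F}$ is the reduced power: the quotient of $D^I$ by the relation $(a_i)\sim(b_i)$ iff $\{i\mid a_i=b_i\}\in\mathcal{F}$, with its induced $D$-vector space structures. *)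

(* Defs.v *)
From HB Require Import structures.
From mathcomp Require Import all_boot all_order all_algebra generic_quotient.
From mathcomp Require Import all_classical.

Set Implicit Arguments.
Unset Strict Implicit.
Unset Printing Implicit Defensive.

Import GRing.Theory.
Local Open Scope classical_set_scope.
Local Open Scope card_scope.
Local Open Scope quotient_scope.
Local Open Scope ring_scope.

(* Cardinals are represented by sets: A stands for the cardinality of A. *)
Definition card_lt (S T : Type) (A : set S) (B : set T) : Prop :=
  A #<= B /\ A #!= B.

(* The cardinality of B is the least cardinal greater than that of A. *)
Definition card_succ (S T : Type) (A : set S) (B : set T) : Prop :=
  card_lt A B /\ forall (U : Type) (C : set U), card_lt A C -> B #<= C.

(* kappa-completeness, for kappa the cardinality of K. *)
Definition complete_filter (I T : Type) (K : set T) (F : set_system I) : Prop :=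
  forall G : set (set I), G `<=` F -> card_lt G K -> F (\bigcap_(A in G) A).

(* For n = 0 the intersection is the improper filter. *)
Definition finite_meet_of_complete_ultrafilters (I T : Type) (K : set T)
    (F : set_system I) : Prop :=
  exists (n : nat) (U : 'I_n -> set_system I),
    (forall i, UltraFilter (U i) /\ complete_filter K (U i)) /\
    F = \bigcap_(i in [set: 'I_n]) U i.

Section ReducedPower.
Context (I : Type) (T : choiceType) (F : filter_on I).

Definition redpow_rel : rel (I -> T) :=
  fun a b => `[< (F : set_system I) [set i | a i = b i] >].

Lemma redpow_rel_refl : reflexive redpow_rel.
Proof. by move=> a; apply/asboolP; apply: filterS (@filterT _ F _) => i. Qed.

Lemma redpow_rel_sym : symmetric redpow_rel.
Proof.
by move=> a b; apply/asboolP/asboolP; apply: filterS => i /= ->.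
Qed.

Lemma redpow_rel_trans : transitive redpow_rel.
Proof.
move=> b a c /asboolP ab /asboolP bc; apply/asboolP.
by apply: filterS (filterI ab bc) => i /= [-> ->].
Qed.

Canonical redpow_equiv :=
  EquivRel redpow_rel redpow_rel_refl redpow_rel_sym redpow_rel_trans.

Definition redpow : Type := {eq_quot redpow_equiv}.

HB.instance Definition _ := Choice.on redpow.
HB.instance Definition _ := EqQuotient.on redpow.

Lemma redpow_eqP (a b : I -> T) :
  reflect ((F : set_system I) [set i | a i = b i]) (\pi_redpow a == \pi_redpow b).
Proof. by rewrite piE; apply: asboolP. Qed.

End ReducedPower.

Arguments redpow {I} T F.
Arguments redpow_eqP {I T F a b}.

Section ReducedPowerModule.
Context (I : Type) (R : pzRingType) (V : lmodType R) (F : filter_on I).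
Local Notation Q := (redpow V F).

Definition redpow_zero : Q := lift_cst Q (0 : I -> V).
Definition redpow_opp : Q -> Q := lift_op1 Q (-%R : (I -> V) -> I -> V).
Definition redpow_add : Q -> Q -> Q :=
  lift_op2 Q (+%R : (I -> V) -> (I -> V) -> I -> V).
Definition redpow_scale (c : R) : Q -> Q :=
  lift_op1 Q ( *:%R c : (I -> V) -> I -> V).

Lemma repr_redpowP (a : I -> V) :
  (F : set_system I) [set i | a i = repr (\pi_Q a) i].
Proof. by apply/redpow_eqP; rewrite reprK. Qed.

Canonical redpow_pi_zero := PiConst redpow_zero.

Lemma redpow_pi_opp : {morph \pi_Q : a / - a >-> redpow_opp a}.
Proof.
move=> a; unlock redpow_opp; apply/eqP/redpow_eqP.
by apply: filterS (repr_redpowP a) => i /= e; congr (- _).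
Qed.
Canonical redpow_pi_opp_morph := PiMorph1 redpow_pi_opp.

Lemma redpow_pi_add : {morph \pi_Q : a b / a + b >-> redpow_add a b}.
Proof.
move=> a b; unlock redpow_add; apply/eqP/redpow_eqP.
apply: filterS (filterI (repr_redpowP a) (repr_redpowP b)) => i /= [ea eb].
by congr (_ + _).
Qed.
Canonical redpow_pi_add_morph := PiMorph2 redpow_pi_add.

Lemma redpow_pi_scale c : {morph \pi_Q : a / c *: a >-> redpow_scale c a}.
Proof.
move=> a; unlock redpow_scale; apply/eqP/redpow_eqP.
by apply: filterS (repr_redpowP a) => i /= e; congr (_ *: _).
Qed.
Canonical redpow_pi_scale_morph c := PiMorph1 (redpow_pi_scale c).

Lemma redpow_addA : associative redpow_add.
Proof. by move=> x y z; rewrite -[x]reprK -[y]reprK -[z]reprK !piE addrA. Qed.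

Lemma redpow_addC : commutative redpow_add.
Proof. by move=> x y; rewrite -[x]reprK -[y]reprK !piE addrC. Qed.

Lemma redpow_add0 : left_id redpow_zero redpow_add.
Proof. by move=> x; rewrite -[x]reprK !piE add0r. Qed.

Lemma redpow_addN : left_inverse redpow_zero redpow_opp redpow_add.
Proof. by move=> x; rewrite -[x]reprK !piE addNr. Qed.

HB.instance Definition _ :=
  GRing.isZmodule.Build Q redpow_addA redpow_addC redpow_add0 redpow_addN.

Lemma redpow_scaleA c d (x : Q) :
  redpow_scale c (redpow_scale d x) = redpow_scale (c * d) x.
Proof. by rewrite -[x]reprK !piE scalerA. Qed.

Lemma redpow_scale1 : left_id 1 redpow_scale.
Proof. by move=> x; rewrite -[x]reprK !piE scale1r. Qed.

Lemma redpow_scaleDr : right_distributive redpow_scale redpow_add.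
Proof.
by move=> c x y; rewrite -[x]reprK -[y]reprK !piE scalerDr.
Qed.

Lemma redpow_scaleDl (x : Q) c d :
  redpow_scale (c + d) x = redpow_add (redpow_scale c x) (redpow_scale d x).
Proof. by rewrite -[x]reprK !piE scalerDl. Qed.

HB.instance Definition _ := GRing.Zmodule_isLmodule.Build R Q
  redpow_scaleA redpow_scale1 redpow_scaleDr redpow_scaleDl.

End ReducedPowerModule.

Definition division_ring (D : unitRingType) : Prop :=
  forall x : D, x != 0 -> x \is a GRing.unit.

Section Dimension.
Context (D : nzRingType) (V : lmodType D).

Definition lin_indep (B : set V) : Prop :=
  forall (s : seq V) (c : V -> D), uniq s -> [set` s] `<=` B ->
    \sum_(v <- s) c v *: v = 0 -> {in s, forall v, c v = 0}.

Definition spanning (B : set V) : Prop :=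
  forall x : V, exists (s : seq V) (c : V -> D),
    [set` s] `<=` B /\ x = \sum_(v <- s) c v *: v.

Definition is_basis (B : set V) : Prop := lin_indep B /\ spanning B.

(* The dimension of V is the cardinality of A. *)
Definition has_dim (T : Type) (A : set T) : Prop :=
  (exists B, is_basis B) /\ forall B, is_basis B -> B #= A.

End Dimension.

Arguments has_dim {D} V {T} A.

Definition left_redpow (D : nzRingType) (I : Type) (F : filter_on I)
  : lmodType D := redpow D^o F.

(* A right D-module is a left module over the converse ring D^c; the carrier
   is still redpow D F, see right_redpow_scaleE. *)
Definition right_redpow (D : nzRingType) (I : Type) (F : filter_on I)
  : lmodType D^c := redpow (D^c)^o F.

Section ScalingOnReducedPowers.
Context (D : nzRingType) (I : Type) (F : filter_on I).

Lemma left_redpow_scaleE (c : D) (a : I -> D) :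
  c *: (\pi_(redpow D F) a : left_redpow D F)
  = \pi_(redpow D F) (fun i => c * a i).
Proof. by rewrite [LHS]piE. Qed.

Lemma right_redpow_scaleE (c : D) (a : I -> D) :
  (c : D^c) *: (\pi_(redpow D F) a : right_redpow D F)
  = \pi_(redpow D F) (fun i => a i * c).
Proof. by rewrite [LHS]piE. Qed.

Lemma left_redpow_addE (a b : I -> D) :
  (\pi_(redpow D F) a : left_redpow D F) + \pi_(redpow D F) b
  = \pi_(redpow D F) (fun i => a i + b i).
Proof. by rewrite [LHS]piE. Qed.

Lemma right_redpow_addE (a b : I -> D) :
  (\pi_(redpow D F) a : right_redpow D F) + \pi_(redpow D F) b
  = \pi_(redpow D F) (fun i => a i + b i).
Proof. by rewrite [LHS]piE. Qed.

End ScalingOnReducedPowers.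

(* Main.v *)
(* By the Erdos-Kaplansky argument it suffices to find card(D) linearly
   independent elements: dim >= card(D) forces card(V) = card(D) * dim(V)
   = dim(V).
   Call a set H of functions D -> D generic if no nontrivial left combination
   of n members of H vanishes at n distinct points.  A maximal generic set H has
   at least card(D) elements: if H is smaller, a further function is built along
   a well-order of D with initial segments smaller than D, its value at x
   avoiding, for all finite R in H and finite C below x, the only value that a
   combination of R agreeing with the function on C could take at x.
   If F is not a finite intersection of card(D)^+-complete ultrafilters, there
   is f : I -> D such that no preimage of a finite set lies in F.  Nontrivial
   combinations of H have finitely many zeros, so the classes of h o f, for h in
   H, are linearly independent in D^I/F.  All of this is left-right symmetric. *)

Require Import Defs.
From mathcomp Require Import all_boot all_order all_algebra all_classical.
From mathcomp Require Import generic_quotient finmap wochoice.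

Set Implicit Arguments.
Unset Strict Implicit.
Unset Printing Implicit Defensive.

Import GRing.Theory.
Local Open Scope classical_set_scope.
Local Open Scope card_scope.
Local Open Scope quotient_scope.
Local Open Scope ring_scope.

(** * Cardinal arithmetic *)

Section Cardinals.

Lemma card_le_exists (T U : Type) (u0 : U) (A : set T) (B : set U) :
  A #<= B -> exists2 f : T -> U, set_fun A B f & set_inj A f.
Proof.
elim/Ppointed: U => U in u0 B *; first by case: (no u0).
by move=> /pcard_leP/injfunPex.
Qed.

Lemma set_inj_card_le (T U : Type) (A : set T) (B : set U) (f : T -> U) :
  set_fun A B f -> set_inj A f -> A #<= B.
Proof.
move=> fAB fi.
by have [|g] := (@injfunPex _ _ A B).2; [exists f | exact: inj_card_le].
Qed.

Lemma surj_card_le (T U : Type) (A : set T) (B : set U) (f : T -> U) :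
  B `<=` f @` A -> B #<= A.
Proof.
by move=> /subset_card_le le; apply: card_le_trans le (card_image_le _ _).
Qed.

Lemma card_le_setX (T T' U U' : Type) (A : set T) (A' : set T')
    (B : set U) (B' : set U') :
  A #<= B -> A' #<= B' -> A `*` A' #<= B `*` B'.
Proof.
have [->|/set0P[a Aa]] := eqVneq (A `*` A') set0; first by rewrite card_ge0.
have card_le_nonempty (S S' : Type) (s : S) (X : set S) (Y : set S') :
    X s -> X #<= Y -> Y !=set0.
  move=> Xs XY; apply: contrapT => nY; have Y0 : Y = set0.
    by apply/seteqP; split=> // y Yy; apply: nY; exists y.
  by move: XY; rewrite Y0 card_le0 => /eqP X0; rewrite X0 in Xs.
move=> AB AB'; have [u _] := card_le_nonempty _ _ _ _ _ (proj1 Aa) AB.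
have [u' _] := card_le_nonempty _ _ _ _ _ (proj2 Aa) AB'.
have [f fAB fi] := card_le_exists u AB.
have [g gAB gi] := card_le_exists u' AB'.
apply: (@set_inj_card_le _ _ _ _ (fun p => (f p.1, g p.2))).
  by move=> [x y] [/= Ax Ay]; split; [exact: fAB | exact: gAB].
move=> [x y] [x' y'] /set_mem[/= Ax Ay] /set_mem[/= Ax' Ay'] [ef eg].
by congr (_, _); [apply: fi ef | apply: gi eg]; apply: mem_set.
Qed.

(** Zorn's lemma on the graphs of partial bijections between [A] and [B]: a maximal one exhausts [A]
    or [B], since otherwise a pair of missed points could be added. *)
Lemma card_le_total (T U : Type) (A : set T) (B : set U) : A #<= B \/ B #<= A.
Proof.
pose P (G : set (T * U)) := G `<=` A `*` B /\
  forall p q, G p -> G q -> (p.1 = q.1 <-> p.2 = q.2).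
have [F FP tot|G [[GAB Ginj] Gmax]] := @Zorn_bigcup (T * U)%type P.
  split=> [p [X /FP[XAB _] /XAB]//|p q [X FX Xp] [Y FY Yq]].
  have [XY|YX] := tot _ _ FX FY.
    by apply: (FP _ FY).2 => //; apply: XY.
  by apply: (FP _ FX).2 => //; apply: YX.
have [/asboolP domG|/asboolPn] := boolP `[< A `<=` fst @` G >].
  left; have [->|/set0P[a Aa]] := eqVneq A set0; first exact: card_ge0.
  have [[a' b] Gab _] := domG _ Aa.
  have /choice[f Gf] : forall x, exists y, A x -> G (x, y).
    move=> x; have [Ax|nAx] := pselect (A x); last by exists b.
    by have [[x' y] Gxy /= <-] := domG _ Ax; exists y.
  apply: (@set_inj_card_le _ _ _ _ f).
    by move=> x Ax; have [] := GAB _ (Gf x Ax).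
  by move=> x y /set_mem Ax /set_mem Ay; have [_] := Ginj _ _ (Gf x Ax) (Gf y Ay).
move=> /existsNP[a /not_implyP[Aa nGa]].
right; have domG : B `<=` snd @` G.
  move=> b Bb; apply: contrapT => nGb.
  apply: (Gmax (G `|` [set (a, b)])).
    split; first by move=> p Gp; left.
    by move=> /(_ (a, b)) Gab; apply: nGa; exists (a, b) => //; exact/Gab/or_intror.
  split=> [p [/GAB //|->//]|p q [Gp|->] [Gq|->]] //=; first exact: Ginj.
    by split=> [e|e]; [case: nGa|case: nGb]; exists p.
  by split=> [e|e]; [case: nGa|case: nGb]; exists q.
have [->|/set0P[b Bb]] := eqVneq B set0; first exact: card_ge0.
have [[a' b'] Gab _] := domG _ Bb.
have /choice[f Gf] : forall x, exists y, B x -> G (y, x).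
  move=> x; have [Ax|nAx] := pselect (B x); last by exists a'.
  by have [[y x'] Gxy /= <-] := domG _ Ax; exists y.
apply: (@set_inj_card_le _ _ _ _ f).
  by move=> x Ax; have [] := GAB _ (Gf x Ax).
by move=> x y /set_mem Ax /set_mem Ay; have [] := Ginj _ _ (Gf x Ax) (Gf y Ay).
Qed.

Lemma card_not_le (T U : Type) (A : set T) (B : set U) : ~ (A #<= B) -> B #<= A.
Proof. by case: (card_le_total A B). Qed.

End Cardinals.

(** * Squares of infinite sets *)

Section Squares.

Lemma infinite_two (T : Type) (A : set T) :
  infinite_set A -> exists a b, [/\ A a, A b & a <> b].
Proof.
move=> infA; have [a Aa] := infinite_setN0 infA.
have [b [Ab ab]] : (A `\ a) !=set0.
  by apply: infinite_setN0; apply: infinite_setD => //; exact: finite_set1.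
by exists a, b; split=> // /esym.
Qed.

(** Two distinct points of [X] serve as tags that separate the elements of [A] from the remaining
    ones of [B] inside the square of [X]. *)
Lemma card_le_setU_square (T U : Type) (A B : set T) (X : set U) :
  infinite_set X -> X `*` X #<= X -> A #<= X -> B #<= X -> A `|` B #<= X.
Proof.
move=> /infinite_two[a [b [Xa Xb ab]]] XX AX BX.
have [f fX fi] := card_le_exists a AX; have [g gX gi] := card_le_exists a BX.
apply: card_le_trans XX.
apply: (@set_inj_card_le _ _ _ _
  (fun x => if x \in A then (a, f x) else (b, g x))).
  move=> x ABx; case: ifPn => [/set_mem Ax|/negP nAx]; split=> //=.
    exact: fX.
  by apply: gX; case: ABx => // /mem_set.
move=> x y /set_mem ABx /set_mem ABy; case: ifPn => Ax; case: ifPn => Ay.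
- by case=> /fi; apply.
- by case=> /ab.
- by case=> /esym/ab.
- have memB z : (A `|` B) z -> z \notin A -> z \in B.
    by move=> [/mem_set -> //|/mem_set].
  by case=> /gi; apply; apply: memB.
Qed.

(* By Zorn there is a maximal infinite X in A carrying an injection
   X * X -> X.  If X were smaller than A, a disjoint copy of X in A `\` X would
   leave room to extend the injection to the union of both. *)
Lemma card_square (T : Type) (A : set T) : infinite_set A -> A `*` A #<= A.
Proof.
move=> infA; have [a Aa] := infinite_setN0 infA.
pose sq (s : set T * (T * T -> T)) := [/\ s.1 `<=` A, infinite_set s.1,
  set_fun (s.1 `*` s.1) s.1 s.2 & set_inj (s.1 `*` s.1) s.2].
pose ext (s t : {s | sq s}) := `[< (sval s).1 `<=` (sval t).1 /\
  {in (sval s).1 `*` (sval s).1, (sval s).2 =1 (sval t).2} >].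
(* A countable subset [range g] of [A] provides the starting pair for Zorn's lemma. *)
have /infiniteP/(card_le_exists a)[g gA gi] := infA.
have rgE : range g #= [set: nat] by apply: inj_card_eq.
have /(card_le_exists a)[f0 f0X f0i] : range g `*` range g #<= range g.
  move: rgE; rewrite card_eq_le => /andP[rg gr].
  apply: card_le_trans (card_le_setX rg rg) _; apply: card_le_trans gr.
  by rewrite setXTT; have := card_nat2; rewrite card_eq_le => /andP[].
have sq0 : sq (range g, f0).
  split=> //=; first by move=> _ [n _ <-]; exact: gA.
  by rewrite /= (eq_finite_set rgE); exact: infinite_nat.
have ext_refl s : ext s s by apply/asboolP; split.
have ext_trans r s t : ext r s -> ext s t -> ext r t.
  move=> /asboolP[rs frs] /asboolP[st fst]; apply/asboolP.
  split=> [|p /[dup] rp /frs ->]; first exact: subset_trans st.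
  apply/fst/mem_set; move/set_mem: rp => [r1 r2].
  by split; apply: rs.
have [C totC|[[X f] sqX] maxX] :=
  ZL_preorder (exist _ _ sq0) ext_refl ext_trans.
  have [/asboolP[s0 Cs0]|/asboolPn C0] := boolP `[< C !=set0 >]; last first.
    by exists (exist _ _ sq0) => s Cs; case: C0; exists s.
  pose X := \bigcup_(s in C) (sval s).1.
  have dir p q : X p -> X q -> exists s, [/\ C s, (sval s).1 p & (sval s).1 q].
    move=> [s Cs sp] [t Ct tq].
    have [/asboolP[st _]|/asboolP[ts _]] := totC _ _ Cs Ct.
      by exists t; split=> //; apply: st.
    by exists s; split=> //; apply: ts.
  (* The functions of a chain are glued: all members defined at [p] agree there, and [a] is the
     value where none is defined. *)
  have /choice[f fE] : forall p, exists z, forall s, C s -> 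
      ((sval s).1 `*` (sval s).1) p -> z = (sval s).2 p.
    move=> p; have [/asboolP[s [Cs sp]]|/asboolPn nC] :=
        boolP `[< exists s, C s /\ ((sval s).1 `*` (sval s).1) p >]; last first.
      by exists a => s Cs sp; case: nC; exists s.
    exists ((sval s).2 p) => t Ct tp.
    have [/asboolP[_ e]|/asboolP[_ e]] := totC _ _ Cs Ct; last apply/esym.
      by apply: e; apply/mem_set.
    by apply: e; apply/mem_set.
  have dir2 p q : (X `*` X) p -> (X `*` X) q -> exists s,
      [/\ C s, ((sval s).1 `*` (sval s).1) p & ((sval s).1 `*` (sval s).1) q].
    move=> [p1 p2] [q1 q2]; have [s [Cs sp1 sp2]] := dir _ _ p1 p2.
    have [t [Ct tq1 tq2]] := dir _ _ q1 q2.
    have [/asboolP[st _]|/asboolP[ts _]] := totC _ _ Cs Ct.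
      by exists t; do 2!split=> //; apply: st.
    by exists s; do 2!split=> //; apply: ts.
  have sqX : sq (X, f).
    split=> /=.
    - by move=> x [s _ sx]; have [sA _ _ _] := svalP s; apply: sA.
    - have [_ + _ _] := svalP s0; apply: sub_infinite_set.
      by move=> x sx; exists s0.
    - move=> p Xp; have [s [Cs sp _]] := dir2 _ _ Xp Xp; rewrite (fE _ _ Cs sp).
      by exists s => //; have [_ _ + _] := svalP s; apply.
    - move=> p q /set_mem Xp /set_mem Xq.
      have [s [Cs sp sq']] := dir2 _ _ Xp Xq.
      rewrite (fE _ _ Cs sp) (fE _ _ Cs sq').
      by have [_ _ _] := svalP s; apply; apply/mem_set.
  exists (exist _ _ sqX) => s Cs; apply/asboolP; split=> /=.
    by move=> x sx; exists s.
  by move=> p /set_mem sp; rewrite (fE _ _ Cs sp).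
have [/= XA infX fX fi] := sqX.
have XX : X `*` X #<= X by apply: set_inj_card_le fX fi.
suff AX : A #<= X.
  apply: card_le_trans (card_le_setX AX AX) _; apply: card_le_trans XX _.
  exact: subset_card_le.
apply: contrapT => nAX.
have /card_not_le/(card_le_exists a)[h hY hi] : ~ (A `\` X #<= X).
  move=> YX; apply: nAX; rewrite -(setDUK XA).
  exact: card_le_setU_square.
pose Z := X `|` h @` X.
have ZX : Z #<= X.
  by apply: card_le_setU_square => //; exact: card_image_le.
have /(card_le_exists a)[k kX ki] : Z `*` Z #<= X.
  by apply: card_le_trans XX; exact: card_le_setX.
pose f' p := if p \in X `*` X then f p else h (k p).
have hX x : X x -> ~ X (h x) by move=> /hY[].
have sqZ : sq (Z, f').
  split=> /=.
  - by move=> x [/XA //|[y /hY[hA _] <-]].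
  - by apply: sub_infinite_set infX; exact: subsetUl.
  - move=> p Zp; rewrite /f'; case: ifPn => [/set_mem Xp|_].
      by left; exact: fX.
    by right; exists (k p) => //; apply: kX.
  - move=> p q Zp Zq; have kp := kX _ (set_mem Zp).
    have kq := kX _ (set_mem Zq).
    rewrite /f'; case: ifPn => Xp; case: ifPn => Xq.
    + exact: fi.
    + by move=> e; case: (hX _ kq); rewrite -e; apply: fX; apply: set_mem.
    + by move=> e; case: (hX _ kp); rewrite e; apply: fX; apply: set_mem.
    + by move=> /hi e; apply: ki => //; apply: e; apply/mem_set.
have /asboolP[/= ZsubX _] : ext (exist _ _ sqZ) (exist _ (X, f) sqX).
  apply: maxX; apply/asboolP; split=> /=; first by left.
  by move=> p Xp; rewrite /f' Xp.
have [x Xx] := infinite_setN0 infX.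
by apply: (hX x) => //; apply: ZsubX; right; exists x.
Qed.

End Squares.

(** * Counting finite subsets, and well-orders with small initial segments *)

Section Smallness.

(** Iterating a pairing function on [A] encodes a sequence. The code [a] of the empty sequence may
    itself be a pair, so the length is stored as well, through an embedding of [nat] in [A]. *)
Lemma card_seqs (T : eqType) (A : set T) :
  infinite_set A -> [set s : seq T | [set` s] `<=` A] #<= A.
Proof.
move=> infA; have AA := card_square infA.
have [a Aa] := infinite_setN0 infA.
have [f fA fi] := card_le_exists a AA.
have /infiniteP/(card_le_exists a)[g gA gi] := infA.
pose enc := foldr (fun x y => f (x, y)) a.
have consA x s : [set` x :: s] `<=` A -> A x /\ [set` s] `<=` A.
  move=> xsA; split=> [|y ys]; apply: xsA => /=; first exact: mem_head.
  by rewrite inE ys orbT.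
have encA s : [set` s] `<=` A -> A (enc s).
  by elim: s => //= x s IH /consA[Ax /IH As]; apply: fA.
apply: (@set_inj_card_le _ _ _ _ (fun s => f (g (size s), enc s))).
  by move=> s As; apply: fA; split; [exact: gA | exact: encA].
move=> s t /set_mem /= As /set_mem /= At e.
have encAA r : [set` r] `<=` A -> (g (size r), enc r) \in A `*` A.
  by move=> Ar; apply/mem_set; split; [exact: gA | exact: encA].
have {e}[e] := fi _ _ (encAA s As) (encAA t At) e.
have {e} := gi _ _ (mem_set I) (mem_set I) e.
elim: s t As At => [|x s IH] [|y t] //= /consA[Ax As] /consA[Ay At] [size_eq].
have consAA z r : A z -> [set` r] `<=` A -> (z, enc r) \in A `*` A.
  by move=> Az Ar; apply/mem_set; split=> //; exact: encA.
by move=> e; have [-> /IH ->] := fi _ _ (consAA _ _ Ax As) (consAA _ _ Ay At) e.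
Qed.

Definition fsubsets (T : choiceType) (A : set T) : set {fset T} :=
  [set R | [set` R] `<=` A].

Lemma card_fsubsets (T : choiceType) (A : set T) :
  infinite_set A -> fsubsets A #<= A.
Proof.
move=> infA; pose S := [set enum_fset R | R in fsubsets A].
apply: (@card_le_trans _ _ _ S).
  apply: (@set_inj_card_le _ _ _ _ (@enum_fset T)).
    by move=> R RA; exists R.
  by move=> R R' _ _; apply: val_inj.
apply: card_le_trans (card_seqs infA).
by apply: subset_card_le => _ [R RA <-].
Qed.

Lemma finite_fsubsets (T : choiceType) (A : set T) :
  finite_set A -> finite_set (fsubsets A).
Proof.
move=> /finite_fsetP[X ->].
apply: (sub_finite_set _ (finite_fset (fpowerset X))).
by move=> R /= RX; rewrite fpowersetE; apply/fsubsetP => x; apply: RX.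
Qed.

Lemma not_card_le_fsubsets (T : choiceType) (U : Type) (D : set U) (A : set T) :
  infinite_set D -> ~ (D #<= A) -> ~ (D #<= fsubsets A).
Proof.
move=> infD DA DfA.
have [/finite_fsubsets|/card_fsubsets] := pselect (finite_set A).
  by move=> /(card_le_finite DfA).
by move=> /(card_le_trans DfA).
Qed.

Lemma not_card_le_setX (T T' U : Type) (D : set U) (A : set T) (B : set T') :
  infinite_set D -> ~ (D #<= A) -> ~ (D #<= B) -> ~ (D #<= A `*` B).
Proof.
move=> infD DA DB DAB; have [AB|BA] := card_le_total A B.
  have [finB|/card_square BB] := pselect (finite_set B).
    apply: infD; apply: card_le_finite DAB _; apply: finite_setX => //.
    exact: card_le_finite AB finB.
  apply: DB; apply: card_le_trans DAB _; apply: card_le_trans BB.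
  exact: card_le_setX.
have [finA|/card_square AA] := pselect (finite_set A).
  apply: infD; apply: card_le_finite DAB _; apply: finite_setX => //.
  exact: card_le_finite BA finA.
apply: DA; apply: card_le_trans DAB _; apply: card_le_trans AA.
exact: card_le_setX.
Qed.

(** If some initial segment of a well-order is as large as [T], take the least [a] bounding one, and
    pull the order back along an injection [g] of [T] into the segment below [a]. Segments then
    inject into segments below points [g x], which are small by minimality of [a]. *)
Lemma initial_well_order (T : eqType) : exists lt : T -> T -> Prop,
  [/\ well_founded lt, forall x y z, lt x y -> lt y z -> lt x z,
      forall x y, [\/ lt x y, x = y | lt y x]
    & forall x, ~ ([set: T] #<= [set y | lt y x])].
Proof.
pose has_min (lt : T -> T -> Prop) := forall A : set T, A !=set0 ->
  exists2 x, A x & forall y, A y -> ~ lt y x.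
have wf_min lt : has_min lt -> well_founded lt.
  move=> ltmin x; apply: contrapT => nx.
  have [|y ny ymin] := ltmin (fun x => ~ Acc lt x); first by exists x.
  by apply: ny; constructor => z zy; apply: contrapT => /ymin.
have [R woR] := well_ordering_principle T.
have woRC : wo_chain R predT by move=> A _; exact: woR.
have Rtot x y : R x y || R y x by exact: (wo_chainW woRC).
have Ranti x y : R x y && R y x -> x = y.
  exact: (wo_chain_antisymmetric woRC).
have Rmin (A : set T) : A !=set0 -> exists2 x, A x & forall y, A y -> R x y.
  move=> [x Ax]; have [|y [[/set_mem Ay ymin] _]] := woR (mem A).
    by exists x; apply/mem_set.
  by exists y => // z Az; apply: ymin; apply/mem_set.
(* Transitivity is read off from the least element of the three-point set. *)
have Rtr x y z : R x y -> R y z -> R x z.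
  move=> xy yz; have [|w + wmin] := Rmin [set x; y; z].
    by exists x; left; left.
  move=> [[]|] we; rewrite -?we in xy yz *.
  - by apply: wmin; right.
  - have -> // : x = w by apply: Ranti; rewrite xy wmin //; left; left.
  - have yw : y = w by apply: Ranti; rewrite yz wmin //; left; right.
    by rewrite yw in xy.
pose lt x y := R x y /\ x <> y.
have lt_min : has_min lt.
  move=> A /Rmin[x Ax xmin]; exists x => // y /xmin xy [yx]; apply.
  by apply: Ranti; rewrite yx.
have lt_tr x y z : lt x y -> lt y z -> lt x z.
  move=> [xy nxy] [yz nyz]; split; first exact: Rtr yz.
  by move=> xz; apply: nxy; apply: Ranti; rewrite xy xz yz.
have lt_tot x y : [\/ lt x y, x = y | lt y x].
  have [->|/eqP xy] := eqVneq x y; first exact: Or32.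
  have /orP[Rxy|Ryx] := Rtot x y; first exact: Or31.
  by apply: Or33; split=> // /esym.
have [bigseg|small] :=
  pselect (exists x, [set: T] #<= [set y | lt y x]); last first.
  exists lt; split; [exact: wf_min | exact: lt_tr | exact: lt_tot |].
  move=> x Tx.
  by apply: small; exists x.
have [a Ta amin] := lt_min _ bigseg.
have [g ga gi] := card_le_exists a Ta.
have {}gi x y : g x = g y -> x = y by apply: gi; exact: mem_set.
exists (fun x y => lt (g x) (g y)); split.
- apply: wf_min => A [x Ax]; have [|_ [y Ay <-] ymin] := lt_min (g @` A).
    by exists (g x), x.
  by exists y => // z Az; apply: ymin; exists z.
- by move=> x y z; exact: lt_tr.
- move=> x y; have [xy|/gi|yx] := lt_tot (g x) (g y); first exact: Or31.
    exact: Or32.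
  exact: Or33.
- move=> x Tx; apply: (amin (g x)); last exact: (ga x).
  apply: card_le_trans Tx _; apply: (@set_inj_card_le _ _ _ _ g) => //.
  by move=> y z _ _; exact: gi.
Qed.

(** Truncating [h] by the default [u0] lets the recursion step [F] act on total functions while it
    still sees only values below [x]. *)
Lemma wf_recursion (T : Type) (U : Type) (u0 : U) (lt : T -> T -> Prop)
    (F : (T -> U) -> T -> U) : well_founded lt ->
  exists h : T -> U, forall x,
    h x = F (fun y => if `[< lt y x >] then h y else u0) x.
Proof.
move=> wf_lt.
pose step x (h : forall y, lt y x -> U) :=
  F (fun y => if pselect (lt y x) is left yx then h y yx else u0) x.
exists (Fix wf_lt (fun _ => U) step) => x.
rewrite Fix_eq /step => [|y h h' hh']; congr F; apply/funext => z.
  by case: pselect => zx; case: asboolP.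
by case: pselect.
Qed.

End Smallness.

(** * Generic sets of functions *)

Lemma seq_max (T : eqType) (lt : T -> T -> Prop) (s : seq T) z :
  (forall x y z, lt x y -> lt y z -> lt x z) ->
  (forall x y, [\/ lt x y, x = y | lt y x]) -> z \in s ->
  exists2 x, x \in s & forall y, y \in s -> y = x \/ lt y x.
Proof.
move=> lt_tr lt_tot; elim: s z => // a [|b s] IH z _.
  by exists a => [|y]; rewrite inE // => /eqP; left.
have [x xs xmax] := IH b (mem_head _ _).
have [ax|ax|xa] := lt_tot a x.
- exists x; first by rewrite inE xs orbT.
  by move=> y; rewrite inE => /orP[/eqP->|/xmax//]; right.
- exists x; first by rewrite inE xs orbT.
  by move=> y; rewrite inE => /orP[/eqP->|/xmax//]; left.
- exists a; first exact: mem_head.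
  move=> y; rewrite inE => /orP[/eqP->|/xmax[->|yx]]; [by left | by right | right].
  exact: lt_tr xa.
Qed.

Section GenericFunctions.
Context (D : unitRingType) (divD : division_ring D).
Hypothesis infD : infinite_set [set: D].
Implicit Types (R : {fset D -> D}) (C : {fset D}) (c : (D -> D) -> D).
Implicit Types (H : set (D -> D)).

Definition combination R c (x : D) : D := \sum_(r <- R) c r * r x.

(** Allowing [C] to be larger than [R] spares cutting it down to the exact size. *)
Definition generic H := forall R C c, [set` R] `<=` H ->
  (#|` R| <= #|` C|)%N -> {in C, forall x, combination R c x = 0} ->
  {in R, forall r, c r = 0}.

Lemma combinationB R c c' x :
  combination R (fun r => c r - c' r) x =
    combination R c x - combination R c' x.
Proof.
by rewrite /combination -sumrB; apply: eq_bigr => r _; rewrite mulrBl.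
Qed.

Lemma combinationZ R a c x :
  combination R (fun r => a * c r) x = a * combination R c x.
Proof.
by rewrite /combination mulr_sumr; apply: eq_bigr => r _; rewrite mulrA.
Qed.

Lemma combinationD1 R h c x : h \in R ->
  combination R c x = c h * h x + combination (R `\ h)%fset c x.
Proof. by move=> hR; rewrite /combination (big_fsetD1 h). Qed.

(** An agreement of [h] with a combination on [C] is refuted at the largest point of [C], whose
    value was chosen knowing [h] at all the other points. *)
Lemma avoiding_function H : generic H -> ~ ([set: D] #<= H) ->
  exists h : D -> D, forall R C c, [set` R] `<=` H -> (#|` R| < #|` C|)%N ->
    ~ {in C, forall x, h x = combination R c x}.
Proof.
move=> genH smallH.
have [lt [wf_lt lt_tr lt_tot small]] := initial_well_order D.
pose extrapolates g x R C (v : D) :=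
  exists2 c, {in C, forall y, g y = combination R c y} & v = combination R c x.
(* One extrapolated value is picked for each pair of finite sets; where there is none, the default 0
   is merely forbidden too. There are fewer pairs than elements of [D], so a permitted value
   remains. *)
pose forbidden g x := [set xget 0 (extrapolates g x p.1 p.2) | p in
  fsubsets H `*` fsubsets [set y | lt y x]].
have /choice[F0 F0E] (gx : (D -> D) * D) : exists v, ~ forbidden gx.1 gx.2 v.
  apply: contrapT => allF.
  have /not_card_le_setX nle := not_card_le_fsubsets infD smallH.
  apply: (nle _ _ infD (not_card_le_fsubsets infD (@small gx.2))).
  apply: card_le_trans (card_image_le
    (fun p => xget 0 (extrapolates gx.1 gx.2 p.1 p.2)) _).
  apply: subset_card_le => v _.
  by apply: contrapT => nv; apply: allF; exists v.
have [h hE] := wf_recursion 0 (fun g x => F0 (g, x)) wf_lt.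
exists h => R C c RH RC hC.
have [x xC Cx] : exists2 x, x \in C & {in (C `\ x)%fset, forall y, lt y x}.
  have /fset0Pn[z zC] : C != fset0.
    by rewrite -cardfs_gt0; apply: leq_ltn_trans RC.
  have [x xC xmax] := seq_max lt_tr lt_tot zC.
  by exists x => // y; rewrite !inE => /andP[/eqP yx /xmax[]].
set g := fun y => if `[< lt y x >] then h y else 0.
have gh y : y \in (C `\ x)%fset -> g y = h y.
  by move=> /Cx yx; rewrite /g asboolT.
have := F0E (g, x); rewrite /= -hE; apply.
exists (R, (C `\ x)%fset); first by split.
have : extrapolates g x R (C `\ x)%fset (h x).
  exists c; last exact: hC.
  by move=> y /[dup] yC /gh ->; apply: hC; move: yC; rewrite !inE => /andP[].
(* The picked value may come from other coefficients [c']. Without [x], the set [C] still has at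
   least as many points as [R], so genericity of [H] gives [c' = c] on [R], and the picked value is
   [h x]. *)
move=> /(xgetI 0)[c' c'C ->]; rewrite (hC _ xC).
apply: eq_big_seq => r rR; congr (_ * _).
apply/eqP; rewrite -subr_eq0; apply/eqP.
apply: (genH R (C `\ x)%fset (fun r => c' r - c r)) rR => //.
  by move: RC; rewrite (cardfsD1 x C) xC.
move=> y yC; rewrite combinationB -c'C // gh // hC ?subrr //.
by move: yC; rewrite !inE => /andP[].
Qed.

(** In a vanishing combination a nonzero coefficient of [h] could be inverted, which would express
    [h] on [C] through fewer functions than [C] has points. Hence it is zero and genericity of [H]
    applies. *)
Lemma generic_setU1 H h : generic H ->
  (forall R C c, [set` R] `<=` H -> (#|` R| < #|` C|)%N ->
    ~ {in C, forall x, h x = combination R c x}) ->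
  generic (h |` H).
Proof.
move=> genH avoid R C c RhH RC combC.
have [hR|hR] := boolP (h \in R); last first.
  apply: (genH R C) => // r rR; have [re|//] := RhH r rR.
  by move: hR; rewrite -re rR.
have RC' : (#|` (R `\ h)%fset| < #|` C|)%N.
  by move: RC; rewrite (cardfsD1 h R) hR.
have RH : [set` (R `\ h)%fset] `<=` H.
  by move=> r /=; rewrite !inE => /andP[rh /RhH[re|//]]; rewrite re eqxx in rh.
have ch0 : c h = 0.
  apply: contrapT => /eqP ch.
  apply: (avoid _ C (fun r => - (c h)^-1 * c r) RH RC').
  move=> x xC; rewrite combinationZ mulNr.
  move/eqP: (combC x xC).
  rewrite (combinationD1 _ _ hR) addrC addr_eq0 => /eqP ->.
  by rewrite mulrN opprK mulKr //; exact: divD.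
move=> r rR; have [->//|rh] := eqVneq r h.
apply: (genH (R `\ h)%fset C c RH (ltnW RC')); last by rewrite !inE rh.
by move=> x xC; rewrite -(combC x xC) (combinationD1 _ _ hR) ch0 mul0r add0r.
Qed.

(** Genericity and linear independence both have finite character; this supplies the chain condition
    of Zorn's lemma for each. *)
Lemma finite_subset_chain (T : eqType) (F : set (set T)) (s : seq T) :
  total_on F subset -> F !=set0 -> [set` s] `<=` \bigcup_(X in F) X ->
  exists2 X, F X & [set` s] `<=` X.
Proof.
move=> tot [X0 FX0]; elim: s => [|x s IH] sF; first by exists X0.
have [X FX sX] := IH (fun y ys => sF y (@mem_behead _ (x :: s) y ys)).
have [Y FY Yx] := sF x (mem_head _ _).
have [XY|YX] := tot _ _ FX FY.
  by exists Y => // y /=; rewrite inE => /orP[/eqP->//|/sX/XY].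
by exists X => // y /=; rewrite inE => /orP[/eqP->|/sX//]; exact: YX.
Qed.

Lemma large_generic : exists2 H, generic H & [set: D] #<= H.
Proof.
have [F Fgen tot|H [genH Hmax]] := @Zorn_bigcup _ generic.
  move=> R C c RF RC combC r rR; have [Y FY _] := RF r rR.
  have [|X FX RX] := finite_subset_chain tot _ RF; first by exists Y.
  exact: (Fgen X FX R C).
exists H => //; apply: contrapT => smallH.
have [h avoid] := avoiding_function genH smallH.
apply: (Hmax (h |` H)); last exact: generic_setU1.
split; first by move=> r Hr; right.
move=> /(_ h (or_introl erefl)) Hh.
(* If [h] were in [H], it would be the combination of [[fset h]] with coefficient 1; two points
   already exceed the single function. *)
have [C _ C2] := infinite_set_fset 2 infD.
apply: (avoid [fset h]%fset C (fun=> 1)).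
  by move=> r /=; rewrite inE => /eqP ->.
  by rewrite cardfs1.
by move=> x _; rewrite /combination big_seq_fset1 mul1r.
Qed.

End GenericFunctions.

(** * Dimension over a division ring *)

Section Dimension.
Context (D : unitRingType) (divD : division_ring D).

(** Gaussian elimination by induction on the columns [s], all row operations being multiplications
    on the left. *)
Lemma left_relation (X Y : eqType) (r : seq X) (s : seq Y) (M : X -> Y -> D) :
  uniq r -> (size s < size r)%N -> exists2 c : X -> D,
    exists2 x, x \in r & c x != 0 &
    forall y, y \in s -> \sum_(x <- r) c x * M x y = 0.
Proof.
elim: s r M => [|y s IH] r M ur sr.
  case: r ur sr => // x r _ _; exists (fun=> 1) => //.
  by exists x; [exact: mem_head | exact: oner_neq0].
have [|/hasPn M0] := boolP (has (fun x => M x y != 0) r); last first.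
  have [c cN0 c0] := IH r M ur (ltnW sr); exists c => // z.
  rewrite inE => /orP[/eqP->|/c0//]; rewrite big_seq big1 // => x /M0.
  by rewrite negbK => /eqP ->; rewrite mulr0.
move=> /hasP[x0 x0r /divD Mx0].
have sr' : (size s < size (rem x0 r))%N by rewrite size_rem //; case: (r) sr.
(* Subtracting a left multiple of the pivot row [x0] from each other row clears column [y]. *)
have [c [x1 x1r cx1] c0] :=
  IH _ (fun x z => M x z - M x y * (M x0 y)^-1 * M x0 z) (rem_uniq x0 ur) sr'.
have neq_x0 x : x \in rem x0 r -> x == x0 = false.
  by rewrite (mem_rem_uniq x0 ur) => /andP[/negbTE].
(* The coefficient of [x0] is solved for from the equation of column [y]. *)
pose a := - \sum_(x <- rem x0 r) c x * M x y * (M x0 y)^-1.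
exists (fun x => if x == x0 then a else c x).
  by exists x1; [exact: mem_rem x1r | rewrite neq_x0].
move=> z; rewrite inE (perm_big _ (perm_to_rem x0r)) big_cons eqxx.
rewrite (eq_big_seq (fun x => c x * M x z)) => [|x /neq_x0 -> //].
rewrite /= /a mulNr mulr_suml addrC => /orP[/eqP ->|/c0 e].
  by apply/eqP; rewrite subr_eq0; apply/eqP/eq_bigr => x _; rewrite mulrVK.
rewrite -[RHS]e -sumrB; apply: eq_bigr => x _.
by rewrite mulrBr !mulrA.
Qed.

Context (V : lmodType D).
Implicit Types (B L : set V) (s r : seq V).

(** A left relation between the rows of the matrix expressing [r] through [s] is a linear relation
    on [r]. *)
Lemma lin_indep_size L r s : lin_indep L -> uniq r -> [set` r] `<=` L ->
  (forall x, x \in r -> exists c : V -> D, x = \sum_(v <- s) c v *: v) ->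
  (size r <= size s)%N.
Proof.
move=> indL ur rL spanr; rewrite leqNgt; apply/negP => sr.
have /choice[M ME] (x : V) :
    exists c : V -> D, x \in r -> x = \sum_(v <- s) c v *: v.
  have [/spanr[c xE]|_] := boolP (x \in r); first by exists c.
  by exists (fun=> 0).
have [c [x xr /eqP cx] c0] := left_relation M ur sr.
apply: cx; apply: (indL r c) => //.
transitivity (\sum_(v <- s) (\sum_(x <- r) c x * M x v) *: v); last first.
  by rewrite big_seq big1 // => v /c0 ->; rewrite scale0r.
under [RHS]eq_bigr do rewrite scaler_suml.
rewrite exchange_big /=; apply: eq_big_seq => v vr; rewrite {2}(ME v vr).
by rewrite scaler_sumr; apply: eq_bigr => u _; rewrite scalerA.
Qed.

(** Spanning allows repeated vectors in [s]; their coefficients are added up over the duplicate-free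
    [r]. *)
Lemma combination_widen s r (c : V -> D) : uniq r -> {subset s <= r} ->
  exists c' : V -> D, \sum_(v <- s) c v *: v = \sum_(v <- r) c' v *: v.
Proof.
move=> ur; elim: s => [_|v s IH sr].
  by exists (fun=> 0); rewrite big_nil big1 // => v _; rewrite scale0r.
have [c' c'E] := IH (fun x xs => sr x (@mem_behead _ (v :: s) x xs)).
exists (fun u => (if u == v then c v else 0) + c' u).
rewrite big_cons c'E; under [RHS]eq_bigr do rewrite scalerDl.
rewrite big_split /=; congr (_ + _).
rewrite (bigD1_seq v) ?sr ?mem_head //= eqxx big1 ?addr0 // => u /negbTE ->.
by rewrite scale0r.
Qed.

(* Only finitely many elements of L are combinations of a given finite
   subset of B. *)
Lemma lin_indep_card_le L B :
  lin_indep L -> infinite_set L -> spanning B -> L #<= B.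
Proof.
move=> indL infL spanB.
have [/finite_seqP[b Bb]|infB] := pselect (finite_set B).
  have [R RL sizeR] := infinite_set_fset (size (undup b)).+1 infL.
  have := @lin_indep_size L R (undup b) indL (fset_uniq R) RL.
  rewrite leqNgt sizeR => /(_ _)/notF; case=> x _.
  have [s [c [sB xE]]] := spanB x; rewrite xE.
  apply: combination_widen (undup_uniq b) _ => v /sB.
  by rewrite Bb mem_undup.
have /choice[supp suppE] (x : V) : exists s : seq V, [set` s] `<=` B /\
    exists c : V -> D, x = \sum_(v <- s) c v *: v.
  by have [s [c [sB xE]]] := spanB x; exists s; split=> //; exists c.
have /choice[g gi] (s : seq V) :
    exists g : V -> nat, set_inj [set x | L x /\ supp x = s] g.
  suff /finite_set_countable/(card_le_exists 0%N)[g _ gi] :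
    finite_set [set x | L x /\ supp x = s] by exists g.
  apply: contrapT => infLs.
  have [R RLs sizeR] := infinite_set_fset (size s).+1 infLs.
  have := @lin_indep_size L R s indL (fset_uniq R).
  rewrite leqNgt sizeR => /(_ _ _)/notF; apply => x xR.
    by have [] := RLs x xR.
  by have [_ <-] := RLs x xR; have [_] := suppE x.
(* An element of [L] is recovered from its support and its number among the finitely many elements
   with that support. *)
apply: (@card_le_trans _ _ _ ([set s | [set` s] `<=` B] `*` [set: nat])).
  apply: (@set_inj_card_le _ _ _ _ (fun x => (supp x, g (supp x) x))).
    by move=> x _; split=> //=; have [] := suppE x.
  move=> x y /set_mem Lx /set_mem Ly [sxy gxy]; apply: (gi (supp x)).
  - exact/mem_set.
  - exact/mem_set.
  - by rewrite gxy sxy.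
apply: card_le_trans (card_square infB).
by apply: card_le_setX; [exact: card_seqs | exact/infiniteP].
Qed.

Lemma basis_exists : exists B : set V, is_basis B.
Proof.
have [F Find tot|B [indB Bmax]] := @Zorn_bigcup V (@lin_indep D V).
  move=> s c us sF sum0 v vs; have [Y FY _] := sF v vs.
  have [|X FX sX] := finite_subset_chain tot _ sF; first by exists Y.
  exact: (Find X FX s c).
exists B; split=> // x; apply: contrapT => nspan.
have nBx : ~ B x.
  move=> Bx; apply: nspan; exists [:: x], (fun=> 1); split.
    by move=> y /=; rewrite inE => /eqP ->.
  by rewrite big_seq1 scale1r.
apply: (Bmax (x |` B)).
  by split=> [y By|/(_ x (or_introl erefl))//]; right.
move=> s c us sB sum0.
have [xs|xs] := boolP (x \in s); last first.
  apply: (indB s c) => // y ys; have [yx|//] := sB y ys.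
  by move: xs; rewrite -yx ys.
have remB : [set` rem x s] `<=` B.
  move=> y /=; rewrite (mem_rem_uniq x us) => /andP[/eqP yx /sB[//|//]].
move: sum0; rewrite (perm_big _ (perm_to_rem xs)) big_cons /= => sum0.
have cx : c x = 0.
  apply: contrapT => /eqP/divD cx; apply: nspan.
  exists (rem x s), (fun v => - (c x)^-1 * c v); split=> //.
  under eq_bigr do rewrite -scalerA.
  rewrite -scaler_sumr; move/eqP: sum0; rewrite addrC addr_eq0 => /eqP ->.
  by rewrite scaleNr scalerN opprK scalerA mulVr // scale1r.
move=> v vs; have [->//|vx] := eqVneq v x.
apply: (indB (rem x s) c) => //.
- exact: rem_uniq.
- by move: sum0; rewrite cx scale0r add0r.
- by rewrite (mem_rem_uniq x us) inE vx.
Qed.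

(** Each vector is the value of a finite sequence of pairs of a scalar and an element of [B], and
    there are at most as many such sequences as elements of [B]. *)
Lemma spanning_card_ge B : infinite_set B -> [set: D] #<= B -> spanning B ->
  [set: V] #<= B.
Proof.
move=> infB DB spanB.
have infDB : infinite_set ([set: D] `*` B).
  apply: contra_not infB => finDB; apply: card_le_finite finDB.
  apply: (@set_inj_card_le _ _ _ _ (fun v => (0 : D, v))); first by [].
  by move=> u v _ _ [].
apply: (@card_le_trans _ _ _ ([set: D] `*` B)); last first.
  by apply: card_le_trans (card_square infB); exact: card_le_setX.
apply: card_le_trans (card_seqs infDB).
apply: (@surj_card_le _ _ _ _
  (fun s : seq (D * V) => \sum_(p <- s) p.1 *: p.2)).
move=> x _; have [s [c [sB xE]]] := spanB x.
exists [seq (c v, v) | v <- s]; last by rewrite big_map xE.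
by move=> _ /= /mapP[v vs ->]; split=> //; exact: sB.
Qed.

(** The independent set [L] makes every basis infinite and at least as large as [D]; such a basis is
    as large as the space it spans. *)
Lemma has_dim_card L : infinite_set [set: D] -> lin_indep L ->
  [set: D] #<= L -> has_dim V [set: V].
Proof.
move=> infD indL DL; split; first exact: basis_exists.
have infL : infinite_set L by apply: contra_not infD; exact: card_le_finite.
move=> B [indB spanB]; have LB := lin_indep_card_le indL infL spanB.
rewrite card_eq_le card_leT /=; apply: spanning_card_ge => //.
  by apply: contra_not infL; exact: card_le_finite.
exact: card_le_trans LB.
Qed.

End Dimension.

(** * Filters *)

Section Filters.
Context (J T : Type).
Hypothesis infT : infinite_set [set: T].

Definition finite_valued (F : set_system J) : Prop :=
  forall f : J -> T, exists2 S, finite_set S & F (f @^-1` S).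

(** If the intersection is not in [U], its complement is. Label each point there by a member of [G]
    missing it. On a set of [U] only finitely many labels occur, but the finitely many labelled
    members meet in a set of [U], a contradiction. *)
Lemma finite_valued_complete (U : set_system J) (G : set (set J)) :
  UltraFilter U -> finite_valued U -> G `<=` U -> G #<= [set: T] ->
  U (\bigcap_(A in G) A).
Proof.
move=> ultraU fvU GU GT; have [t0 _] := infinite_setN0 infT.
have [e _ ei] := card_le_exists t0 GT.
have [//|UN] := in_ultra_setVsetC (\bigcap_(A in G) A) ultraU.
have /choice[f fE] (i : J) : exists t, ~ (\bigcap_(A in G) A) i ->
    exists A, [/\ G A, ~ A i & t = e A].
  have [Ni|/existsNP[A /not_implyP[GA nAi]]] :=
    pselect ((\bigcap_(A in G) A) i).
    by exists t0.
  by exists (e A) => _; exists A.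
(* [g] decodes labels; a [t] that labels no member of [G] gets [setT], which stays in [U]. *)
have /choice[g gE] (t : {classic T}) :
    exists A, U A /\ forall B, G B -> e B = t -> B = A.
  have [[A [GA eA]]|nA] := pselect (exists A, G A /\ e A = t).
    exists A; split=> [|B GB eB]; first exact: GU.
    by apply: ei; [exact: mem_set..|rewrite eA].
  exists setT; split=> [|B GB eB]; first exact: filterT.
  by case: nA; exists B.
have [S finS US] := fvU f.
have [X SX] := (@finite_fsetP {classic T} S).1 finS.
have Ug : U (\bigcap_(t in [set` X]) g t).
  by apply: filter_bigI => t _; have [] := gE t.
have [i [[Ni Si] gi]] := filter_ex (filterI (filterI UN US) Ug).
have [A [GA nAi fi]] := fE i Ni.
case: nAi; have [_ /(_ A GA erefl) ->] := gE (e A).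
by apply: (gi (e A)); move: Si; rewrite SX /= fi.
Qed.

(* The filter generated by F and A. *)
Definition localize (F : set_system J) (A : set J) : set_system J :=
  [set X | F (X `|` ~` A)].

Definition finite_meet_of_ultrafilters (F : set_system J) : Prop :=
  exists (n : nat) (U : 'I_n -> set_system J),
    (forall i, UltraFilter (U i)) /\ F = \bigcap_(i in [set: 'I_n]) U i.

Section Localize.
Context (F : set_system J) {FF : Filter F}.

(** Localizing at a union gives the intersection of the two localizations, so the two lists of
    ultrafilters are concatenated. *)
Lemma localize_setU A B :
  finite_meet_of_ultrafilters (localize F A) ->
  finite_meet_of_ultrafilters (localize F B) ->
  finite_meet_of_ultrafilters (localize F (A `|` B)).
Proof.
move=> [m [U [ultraU UE]]] [n [W [ultraW WE]]].
exists (m + n)%N, (fun i =>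
  match fintype.split i with inl j => U j | inr k => W k end).
split=> [i|]; first by case: splitP.
have -> : localize F (A `|` B) = localize F A `&` localize F B.
  apply/seteqP; split=> [X FX|X [FA FB]].
    split; apply: (@filterS _ F _ _ _ _ FX) => x [Xx|nABx];
      [by left | right | by left | right].
      by move=> Ax; apply: nABx; left.
    by move=> Bx; apply: nABx; right.
  apply: (@filterS _ F _ _ _ _ (@filterI _ F _ _ _ FA FB)) =>
    x [[Xx|nA] [Xx'|nB]];
    [by left | by left | by left | by right=> -[]].
rewrite UE WE; apply/seteqP; split=> [X [XU XW] i _|X XUW].
  by case: splitP => j _; [exact: XU | exact: XW].
split=> j _.
  by have := XUW (lshift n j) I; rewrite (unsplitK (inl j)).
by have := XUW (rshift m j) I; rewrite (unsplitK (inr j)).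
Qed.

(** The localization is improper, that is, the meet of no ultrafilters. *)
Lemma localize_null A : F (~` A) -> finite_meet_of_ultrafilters (localize F A).
Proof.
move=> FA; exists 0%N, (fun=> setT); split=> [[]//|].
apply/seteqP; split=> // X _; rewrite /localize /=.
by apply: filterS FA => x; right.
Qed.

(** For each [X] the null piece puts [X] or its complement into the localization, which is therefore
    itself an ultrafilter. *)
Lemma localize_atom A : ~ F (~` A) ->
  (forall X, F (~` (A `&` X)) \/ F (~` (A `\` X))) ->
  finite_meet_of_ultrafilters (localize F A).
Proof.
move=> posA atomA; exists 1%N, (fun=> localize F A); split; last first.
  by apply/seteqP; split=> [X FX i //|X /(_ ord0 I)].
move=> _; have locF : Filter (localize F A).
  split; first by rewrite /localize /= setTU; exact: filterT.
    move=> X Y FX FY; apply: (@filterS _ F _ _ _ _ (@filterI _ F _ _ _ FX FY)) =>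
      x [[Xx|nA] [Yx|nA']];
      by [left | right].
  by move=> X Y XY; apply: (@filterS _ F) => x [/XY|]; [left | right].
split=> [|G properG locG].
  by split=> //; rewrite /localize /= set0U.
apply/seteqP; split=> // X GX; have [nAX|nAX] := atomA X; last first.
  by apply: (@filterS _ F _ _ _ _ nAX) => x /not_andP[nAx|/contrapT Xx];
    [right | left].
have : G (X `&` ~` X).
  apply: filterI GX _; apply: locG; apply: (@filterS _ F _ _ _ _ nAX).
  by move=> x /not_andP[nAx|nXx]; [right | left].
by rewrite setICr => /filter_not_empty.
Qed.

(* Otherwise, repeatedly splitting a piece that is not a finite meet yields a
   sequence of disjoint F-positive sets, and the function numbering them is not
   finite-valued modulo F. *)
Lemma finite_valued_meet : finite_valued F -> finite_meet_of_ultrafilters F.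
Proof.
move=> fvF; have -> : F = localize F setT.
  by apply/funext => X; rewrite /localize /= setCT setU0.
apply: contrapT => badT.
pose bad A := ~ finite_meet_of_ultrafilters (localize F A).
have /choice[nxt nxtE] (A : set J) : exists B, bad A ->
    [/\ B `<=` A, bad B & ~ F (~` (A `\` B))].
  have [goodA|badA] := pselect (finite_meet_of_ultrafilters (localize F A)).
    by exists A => /(_ goodA).
  have posA : ~ F (~` A) by move=> /localize_null.
  (* As [A] is not an atom, some [X] cuts it into two positive pieces. By [localize_setU] one of
     them is bad; it is kept as [B], and the discarded piece is positive. *)
  have /existsNP[X /not_orP[posAX posADX]] :
      ~ forall X, F (~` (A `&` X)) \/ F (~` (A `\` X)).
    by move=> /(localize_atom posA).
  have [goodX|badX] :=
    pselect (finite_meet_of_ultrafilters (localize F (A `&` X))).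
    exists (A `\` X) => _; split; [exact: subDsetl | | by rewrite setDD].
    by move=> /(localize_setU goodX); rewrite setUIDK.
  by exists (A `&` X) => _;
    split; [exact: subIsetl | | rewrite setDIr setDv set0U].
pose A n := iter n nxt setT.
have badA n : bad (A n) by elim: n => //= n /nxtE[].
have subA m n : (m <= n)%N -> A n `<=` A m.
  move=> /subnK <-; elim: (n - m)%N => //= k IH; apply: subset_trans IH.
  by have [] := nxtE _ (badA (k + m)%N).
have [t0 _] := infinite_setN0 infT.
have /infiniteP/(card_le_exists t0)[e _ ei] := infT.
have /choice[f fE] (i : J) : exists t, forall n, (A n `\` A n.+1) i -> t = e n.
  have [[n [Ani nAi]]|nA] := pselect (exists n, (A n `\` A n.+1) i); last first.
    by exists (e 0%N) => n An; case: nA; exists n.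
  exists (e n) => m [Ami nAmi].
  suff -> : n = m by [].
  have [mn|nm|//] := ltngtP m n.
    by case: nAmi; exact: subA mn _ Ani.
  by case: nAi; exact: subA nm _ Ami.
have [S finS FS] := fvF f.
(* A finite [S] misses some label [e n], so a preimage of [S] in [F] would make the [n]-th discarded
   piece null. *)
have [n nSn] : exists n, ~ S (e n).
  apply: contrapT => allS; apply: infinite_nat.
  apply: card_le_finite finS; apply: (@set_inj_card_le _ _ _ _ e) => // n _.
  by apply: contrapT => nS; apply: allS; exists n.
have [_ _] := nxtE _ (badA n); apply; apply: filterS FS => i Si Ani.
by apply: nSn; rewrite -(fE _ _ Ani).
Qed.

End Localize.

(** Otherwise [F] is finite-valued, hence a finite meet of ultrafilters. Each of them contains [F],
    so it is finite-valued as well and therefore complete. *)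
Lemma scattering_function (K : Type) (F : set_system J) :
  Filter F -> card_succ [set: T] [set: K] ->
  ~ finite_meet_of_complete_ultrafilters [set: K] F ->
  exists f : J -> T, forall S, finite_set S -> ~ F (f @^-1` S).
Proof.
move=> FF [_ succK] notF; apply: contrapT => nf.
have fvF : finite_valued F.
  move=> f; apply: contrapT => nS; apply: nf; exists f => S finS FS.
  by apply: nS; exists S.
have [n [U [ultraU FE]]] := finite_valued_meet fvF.
apply: notF; exists n, U; split=> // i; split=> // G GU [GK nGK].
apply: finite_valued_complete GU _ => //.
  move=> f; have [S finS FS] := fvF f; exists S => //.
  by move: FS; rewrite FE => /(_ i I).
(* A family smaller than the successor [K] has at most as many members as [T], since otherwise
   minimality of [K] bounds [K] by the family. *)
apply: contrapT => nGT; have TG := card_not_le nGT.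
have /succK KG : card_lt [set: T] G.
  by split=> //; apply/negP; rewrite card_eq_le => /andP[].
by move/negP: nGK; apply; rewrite card_eq_le GK.
Qed.

End Filters.

(** * Reduced powers *)

Section ReducedPowerDimension.
Context (D : unitRingType) (divD : division_ring D).
Hypothesis infD : infinite_set [set: D].
Context (I : Type) (F : filter_on I) (f : I -> D).
Hypothesis fF : forall S, finite_set S -> ~ (F : set_system I) (f @^-1` S).

Definition pull (h : D -> D) : left_redpow D F :=
  \pi_(redpow D F) (fun i => h (f i)).

Lemma pull_sum (r : seq (D -> D)) (c : (D -> D) -> D) :
  \sum_(h <- r) c h *: pull h =
  \pi_(redpow D F) (fun i => \sum_(h <- r) c h * h (f i)) :> left_redpow D F.
Proof.
elim: r => [|h r IH].
  rewrite big_nil; apply/esym.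
  have -> : (fun i => \sum_(h <- [::]) c h * h (f i)) = (0 : I -> D^o).
    by apply/funext => i; rewrite big_nil.
  by rewrite [RHS]piE.
rewrite big_cons IH [c h *: _]left_redpow_scaleE left_redpow_addE.
by congr (\pi_(redpow D F) _); apply/funext => i; rewrite big_cons.
Qed.

(** Indexing the relation by functions rather than by their classes lets it yield injectivity of
    [pull] on [H] too, with [r] a pair. *)
Lemma pull_indep (H : set (D -> D)) (r : seq (D -> D)) (c : (D -> D) -> D) :
  generic H -> uniq r -> [set` r] `<=` H ->
  \sum_(h <- r) c h *: pull h = 0 -> {in r, forall h, c h = 0}.
Proof.
move=> genH ur rH sum0; pose R := [fset h in r]%fset.
have Rr : perm_eq R r by apply: uniq_perm => // h; rewrite inE.
pose Z := [set x | combination R c x = 0].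
have FZ : (F : set_system I) (f @^-1` Z).
  suff /redpow_eqP : \pi_(redpow D F) (fun i => combination R c (f i)) ==
      \pi_(redpow D F) (0 : I -> D^o) by [].
  apply/eqP; transitivity (0 : left_redpow D F); last by rewrite [LHS]piE.
  rewrite -sum0 pull_sum; congr (\pi_(redpow D F) _); apply/funext => i.
  exact: perm_big.
(* The zero set [Z] has its preimage under [f] in [F], so it is infinite and contains enough points
   for genericity. *)
have infZ : infinite_set Z by move=> /fF.
have [C CZ sizeC] := infinite_set_fset #|` R| infZ.
move=> h hr; apply: (genH R C) => //.
- by move=> k /=; rewrite inE => /rH.
- by rewrite inE.
Qed.

Lemma pull_inj (H : set (D -> D)) : generic H -> set_inj H pull.
Proof.
move=> genH h k /set_mem Hh /set_mem Hk hk; apply: contrapT => /eqP nhk.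
pose c g : D := if g == h then 1 else -1.
have/eqP : c h = 0; last by rewrite /c eqxx oner_eq0.
apply: (pull_indep (r := [:: h; k]) (c := c) genH).
- by rewrite /= inE nhk.
- by move=> g /=; rewrite !inE => /orP[] /eqP ->.
- rewrite !big_cons big_nil /c eqxx eq_sym (negbTE nhk) addr0 hk.
  by rewrite scaleN1r scale1r subrr.
- exact: mem_head.
Qed.

Lemma lin_indep_pull (H : set (D -> D)) : generic H -> lin_indep (pull @` H).
Proof.
move=> genH s c us sH sum0.
have /choice[g gE] (v : left_redpow D F) :
    exists h : D -> D, v \in s -> H h /\ pull h = v.
  have [/sH[h Hh hv]|_] := boolP (v \in s); first by exists h.
  by exists id.
have sE : s = map pull (map g s).
  rewrite -map_comp -[LHS]map_id; apply/eq_in_map => v vs /=.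
  by have [_ ->] := gE v vs.
have gs0 : {in map g s, forall h, c (pull h) = 0}.
  apply: (@pull_indep H (map g s) (c \o pull)) => //.
  - by apply: (@map_uniq _ _ pull); rewrite -sE.
  - by move=> _ /= /mapP[v vs ->]; have [] := gE v vs.
  - by move: sum0; rewrite {1}sE big_map.
move=> v vs; have [_ <-] := gE v vs; apply: gs0.
exact: map_f.
Qed.

Lemma has_dim_left_redpow : has_dim (left_redpow D F) [set: redpow D F].
Proof.
have [H genH DH] := large_generic divD infD.
apply: (has_dim_card divD infD (lin_indep_pull genH)).
apply: card_le_trans DH _.
apply: (@set_inj_card_le _ _ _ _ pull); last exact: pull_inj.
by move=> h Hh; exists h.
Qed.

End ReducedPowerDimension.

Theorem theorem11 (D : unitRingType) (I K : Type) (F : filter_on I)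
  (divD : division_ring D)
  (infD : infinite_set [set: D])
  (succK : card_succ [set: D] [set: K])
  (notF : ~ finite_meet_of_complete_ultrafilters [set: K] F) :
  has_dim (left_redpow D F) [set: redpow D F] /\
  has_dim (right_redpow D F) [set: redpow D F].
Proof.
have [f fF] := scattering_function infD (filter_class F) succK notF.
split; first exact: (has_dim_left_redpow divD infD fF).
(* The converse ring has the same carrier and the same units, so the hypotheses and the function [f]
   carry over unchanged. *)
exact: (@has_dim_left_redpow D^c divD infD I F f fF).
Qed.
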